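(* Let $k\geq 1$ and suppose that a $C^*$-algebra $A$ is $\mathbb{Z}^k$-graded in Exel's sense, with grading subspaces $\{A_n:n\in\mathbb{Z}^k\}$. Suppose also that there is a bounded linear map $F:A\to A_0$ such that $F|_{A_n}=0$ for $n\neq 0$ and $F|_{A_0}$ is the identity. Let $\alpha$ be the strongly continuous action of $\mathbb{T}^k$ on $A$ satisfying $\alpha_z(a)=z^n a$ for $z\in\mathbb{T}^k$, $n\in\mathbb{Z}^k$ and $a\in A_n$. For $a\in A$ and $n\in\mathbb{Z}^k$ define $$a_n:=\int_{\mathbb{T}^k}\alpha_z(a)z^{-n}\,dz,$$ and set $$s_n(a):=\sum_{-n\leq m\leq n}a_m\quad\text{for } n\in\mathbb{N}^k,$$ $$\sigma_N(a):=\frac{1}{\prod_{j=1}^k(N_j+1)}\sum_{0\leq n\leq N}s_n(a)\quad\text{for } N\in\mathbb{N}^k.$$ Then for every $a\in A$, $\|\sigma_N(a)-a\|\to 0$ as $N\to\infty$ in $\mathbb{N}^k$.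
   Context: A $C^*$-algebra $A$ is $\mathbb{Z}^k$-graded in Exel's sense if there is a family $\{A_n:n\in\mathbb{Z}^k\}$ of linearly independent closed linear subspaces of $A$ such that $a\in A_m$ and $b\in A_n$ imply $ab\in A_{m+n}$ and $a^*\in A_{-m}$, and such that $A$ is the norm-closure of $\bigoplus_{n\in\mathbb{Z}^k}A_n$. $\mathbb{N}$ contains $0$; for $m,n\in\mathbb{Z}^k$, $m\leq n$ means $n-m\in\mathbb{N}^k$; the sums over $m$ and $n$ range over elements of $\mathbb{Z}^k$ satisfying the displayed inequalities. $\mathbb{T}=\{z\in\mathbb{C}:|z|=1\}$, $z^n:=\prod_{j=1}^k z_j^{n_j}$ for $z\in\mathbb{T}^k$ and $n\in\mathbb{Z}^k$, and $dz$ is normalised Haar measure on $\mathbb{T}^k$. A strongly continuous action $\alpha$ of $\mathbb{T}^k$ on $A$ is a homomorphism $z\mapsto\alpha_z$ into the group of $*$-automorphisms of $A$ with $z\mapsto\alpha_z(a)$ norm-continuous for each $a\in A$. Under the stated hypotheses on $A$ and $F$, an action $\alpha$ with the stated property exists, and it is unique because $\bigoplus_n A_n$ is dense in $A$. Convergence as $N\to\infty$ in $\mathbb{N}^k$ means convergence of the net indexed by $\mathbb{N}^k$ directed by $\leq$ (i.e. as all $N_j\to\infty$). *)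

(* Defs.v *)
From HB Require Import structures.
From mathcomp Require Import all_boot all_order all_algebra.
From mathcomp Require Import all_classical all_reals all_analysis.
From mathcomp Require Import complex.

Set Implicit Arguments.
Unset Strict Implicit.
Unset Printing Implicit Defensive.

Import Order.TTheory GRing.Theory Num.Theory.
Import numFieldNormedType.Exports.
Local Open Scope classical_set_scope.
Local Open Scope complex_scope.
Local Open Scope ring_scope.

(** Complex C*-algebras, not assumed unital.  The norm of a normed module over
    [R[i]] takes its values in [R[i]] (they are nonnegative, hence real). *)

HB.mixin Record CompleteNormedModule_isCstarAlgebra (R : realType) A
    & CompleteNormedModule R[i] A := {
  cmul : A -> A -> A;
  cstar : A -> A;
  cmulA : forall x y z : A, cmul x (cmul y z) = cmul (cmul x y) z;
  cmulDl : forall x y z : A, cmul (x + y) z = cmul x z + cmul y z;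
  cmulDr : forall x y z : A, cmul x (y + z) = cmul x y + cmul x z;
  cscalerAl : forall (c : R[i]) (x y : A), cmul (c *: x) y = c *: cmul x y;
  cscalerAr : forall (c : R[i]) (x y : A), cmul x (c *: y) = c *: cmul x y;
  cstarK : forall x : A, cstar (cstar x) = x;
  cstarD : forall x y : A, cstar (x + y) = cstar x + cstar y;
  cstarZ : forall (c : R[i]) (x : A), cstar (c *: x) = c^* *: cstar x;
  cstarM : forall x y : A, cstar (cmul x y) = cmul (cstar y) (cstar x);
  cnormM_le : forall x y : A, `|cmul x y| <= `|x| * `|y|;
  cnorm_star : forall x : A, `|cmul (cstar x) x| = `|x| ^+ 2
}.

#[short(type="cstarAlgType")]
HB.structure Definition CstarAlgebra (R : realType) :=
  {A of CompleteNormedModule_isCstarAlgebra R A & CompleteNormedModule R[i] A}.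

Definition star_automorphism (R : realType) (A : cstarAlgType R)
    (f : A -> A) : Prop :=
  [/\ forall (c : R[i]) (x y : A), f (c *: x + y) = c *: f x + f y,
      forall x y : A, f (cmul x y) = cmul (f x) (f y),
      forall x : A, f (cstar x) = cstar (f x)
    & bijective f].

(** Z^k and N^k; Z^k has the pointwise zmodType structure of {ffun _}. *)

Notation Zk k := {ffun 'I_k -> int}.
Notation Nk k := {ffun 'I_k -> nat}.

Definition Nk_Zk (k : nat) (n : Nk k) : Zk k := [ffun j => (n j)%:Z].

Definition Zk_le (k : nat) (m n : Zk k) : Prop := forall j, m j <= n j.

Definition Zk_itv (k : nat) (m n : Zk k) : set (Zk k) :=
  [set p | Zk_le m p /\ Zk_le p n].

(** The sections of the directed set N^k: [f @ Nk_oo k --> l] is convergence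
    of the net [f]. *)
Definition Nk_oo (k : nat) : set_system (Nk k) :=
  filter_from setT (fun N0 => [set N | Zk_le (Nk_Zk N0) (Nk_Zk N)]).
Arguments Nk_oo : clear implicits.

(** The torus T^k, as a topological subspace of C^k; [R[i]^o] is the copy of
    [R[i]] carrying its norm topology. *)

Definition torus_set (R : realType) (k : nat) : set 'rV[R[i]^o]_k :=
  [set z : 'rV[R[i]^o]_k | forall j, `|z ord0 j| = 1].
Arguments torus_set : clear implicits.

Definition torus (R : realType) (k : nat) : Type := set_type (torus_set R k).

HB.instance Definition _ (R : realType) (k : nat) :=
  Topological.on (torus R k).

Definition tcoord (R : realType) (k : nat) (z : torus R k) (j : 'I_k) : R[i] :=
  set_val z ord0 j.

Lemma torus_one_subproof (R : realType) (k : nat) :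
  (const_mx 1 : 'rV[R[i]^o]_k) \in torus_set R k.
Proof. by apply/mem_set => j; rewrite mxE normr1. Qed.

Definition torus_one (R : realType) (k : nat) : torus R k :=
  exist (fun v => v \in torus_set R k) _ (torus_one_subproof R k).

HB.instance Definition _ (R : realType) (k : nat) :=
  isPointed.Build (torus R k) (torus_one R k).

Lemma torus_mul_subproof (R : realType) (k : nat) (z w : torus R k) :
  (\row_j (tcoord z j * tcoord w j) : 'rV[R[i]^o]_k) \in torus_set R k.
Proof.
apply/mem_set => j; rewrite mxE normrM.
by rewrite (set_mem (valP z) j) (set_mem (valP w) j) mulr1.
Qed.

Definition torus_mul (R : realType) (k : nat) (z w : torus R k) : torus R k :=
  exist (fun v => v \in torus_set R k) _ (torus_mul_subproof z w).

Definition torus_exp (R : realType) (k : nat) (z : torus R k) (n : Zk k) : R[i] :=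
  \prod_(j < k) (tcoord z j ^ n j).

Definition borel_torus (R : realType) (k : nat) :=
  g_sigma_algebraType (@open (torus R k)).

(** Normalised Haar measure: the translation-invariant Borel probability
    measure (regularity is automatic on the compact metrisable group T^k). *)
Definition normalised_haar (R : realType) (k : nat)
    (mu : {measure set (borel_torus R k) -> \bar R}) : Prop :=
  mu setT = 1%E /\
  forall (w : torus R k) (E : set (borel_torus R k)), measurable E ->
    mu (torus_mul w @^-1` E) = mu E.

(** The Bochner integral of Banach-space-valued functions. *)

Section bochner.
Context (R : realType) (V : completeNormedModType R[i]).
Context (d : measure_display) (X : measurableType d).
Variable mu : {measure set X -> \bar R}.

Definition is_simple (s : X -> V) : Prop :=
  [/\ finite_set (range s),
      forall v, measurable (s @^-1` [set v])
    & forall v, v != 0 -> (mu (s @^-1` [set v]) < +oo)%E].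

Definition simple_integral (s : X -> V) : V :=
  \sum_(v \in range s) (fine (mu (s @^-1` [set v])))%:C *: v.

Definition is_bochner_integral (f : X -> V) (I : V) : Prop :=
  exists s : nat -> X -> V,
    [/\ forall i, is_simple (s i),
        forall i, measurable_fun setT (fun x => complex.Re `|f x - s i x|),
        (\int[mu]_x (complex.Re `|f x - s i x|)%:E)%E @[i --> \oo] --> 0%E
      & simple_integral (s i) @[i --> \oo] --> I].

(** The value is 0 when [f] is not Bochner integrable. *)
Definition bochner (f : X -> V) : V := xget 0 (is_bochner_integral f).

End bochner.

Section graded.
Context (R : realType) (k : nat) (A : cstarAlgType R).
Implicit Types alpha : torus R k -> A -> A.

Definition closed_subspace (W : set A) : Prop :=
  [/\ W 0,
      forall (c : R[i]) (x y : A), W x -> W y -> W (c *: x + y)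
    & closed W].

Definition independent_subspaces (A_ : Zk k -> set A) : Prop :=
  forall (s : seq (Zk k)) (x : Zk k -> A), uniq s ->
    (forall n, A_ n (x n)) -> \sum_(n <- s) x n = 0 ->
    forall n, n \in s -> x n = 0.

Definition algebraic_sum (A_ : Zk k -> set A) : set A :=
  [set a | exists (s : seq (Zk k)) (x : Zk k -> A),
     (forall n, A_ n (x n)) /\ a = \sum_(n <- s) x n].

Record exel_grading (A_ : Zk k -> set A) : Prop := ExelGrading {
  exel_subspace : forall n, closed_subspace (A_ n);
  exel_independent : independent_subspaces A_;
  exel_mul : forall m n a b, A_ m a -> A_ n b -> A_ (m + n) (cmul a b);
  exel_star : forall m a, A_ m a -> A_ (- m) (cstar a);
  exel_dense : closure (algebraic_sum A_) = setT
}.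

(** Bounded linear maps A -> A_0 as maps A -> A with values in A_0. *)
Record bounded_projection (A_ : Zk k -> set A) (F : A -> A) : Prop := BoundedProjection {
  bproj_linear : forall (c : R[i]) (x y : A), F (c *: x + y) = c *: F x + F y;
  bproj_bounded : exists M : R, forall x : A, `|F x| <= M%:C * `|x|;
  bproj_range : forall x : A, A_ 0 (F x);
  bproj_zero : forall n, n != 0 -> forall a, A_ n a -> F a = 0;
  bproj_id : forall a, A_ 0 a -> F a = a
}.

Record strongly_continuous_action alpha : Prop := StronglyContinuousAction {
  sca_aut : forall z, star_automorphism (alpha z);
  sca_mul : forall z w a, alpha (torus_mul z w) a = alpha z (alpha w a);
  sca_continuous : forall a : A, continuous (fun z => alpha z a)
}.

Definition implements_grading (A_ : Zk k -> set A) alpha : Prop :=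
  forall (z : torus R k) (n : Zk k) (a : A),
    A_ n a -> alpha z a = torus_exp z n *: a.

Variable mu : {measure set (borel_torus R k) -> \bar R}.

Definition fourier_coef alpha (a : A) (n : Zk k) : A :=
  bochner mu (fun z : borel_torus R k => torus_exp z (- n) *: alpha z a).

Definition partial_sum alpha (n : Zk k) (a : A) : A :=
  \sum_(m \in Zk_itv (- n) n) fourier_coef alpha a m.

Definition fejer_mean alpha (N : Nk k) (a : A) : A :=
  (\prod_(j < k) ((N j).+1%:R : R[i]))^-1 *:
    \sum_(n \in Zk_itv 0 (Nk_Zk N)) partial_sum alpha n a.

End graded.

(* Main.v *)
Require Import Defs.
From mathcomp Require Import all_boot all_order all_algebra.
From mathcomp Require Import all_classical all_reals all_analysis.
From mathcomp Require Import finmap measurable_realfun complex zify lra.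

Set Implicit Arguments.
Unset Strict Implicit.
Unset Printing Implicit Defensive.

Import Order.TTheory GRing.Theory Num.Theory.
Import numFieldNormedType.Exports.
Local Open Scope classical_set_scope.
Local Open Scope complex_scope.
Local Open Scope ring_scope.

(** The theorem is Fejer's theorem for the action alpha.  The mean sigma_N(a) is the
    Bochner integral of K_N(z) alpha_z(a), where K_N is the Fejer kernel of the
    torus ([fejer_mean_bochner]).  Three facts give the convergence.

    The means are contractive ([fejer_mean_contractive]).  Indeed K_N is a product
    over the coordinates of squared moduli of geometric sums, hence nonnegative
    ([fejer_kernel_ge0]), its integral is 1, and each alpha_z is contractive.  The
    last point is the automatic contractivity of *-homomorphisms
    ([hom_contractive]).  It is proved without spectral theory: a self-adjoint h of
    norm less than 1 satisfies h^2 + (1 - y)^2 = 1 for some self-adjoint y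
    commuting with h, this equation is preserved by a *-homomorphism, and it says
    that h is the real part of a unitary, so it forces the norm of h to be at
    most 1.

    On a homogeneous element x of degree p, the mean sigma_N(x) is x times the
    product of the weights max(0, N_j + 1 - |p_j|)/(N_j + 1), which tends to 1
    ([fejer_mean_homogeneous]).  This rests on the orthogonality of characters: the
    integral of z^p x vanishes for nonzero p, because translating by a point w with
    w^p = -1 changes its sign ([bochner_character]).

    Finite sums of homogeneous elements are dense, so contractivity carries the
    convergence to all of A ([fejer_mean_cvg]).

    Integrals have to be handled through approximation by simple functions.
    Continuous functions on the compact torus are uniform limits of simple ones,
    and this suffices for the existence, uniqueness, linearity, norm bound and
    translation invariance of their integrals. *)

(** * Real-valued norms *)

Definition nrm (R : realType) (V : normedZmodType R[i]) (x : V) : R :=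
  complex.Re `|x|.

Section nrm.
Context (R : realType) (V : normedZmodType R[i]).
Implicit Types x y : V.

Lemma nrmE x : `|x| = (nrm x)%:C.
Proof. by rewrite /nrm RRe_real// ger0_real. Qed.

Lemma nrm_ge0 x : 0 <= nrm x.
Proof. by rewrite -ler0c -nrmE. Qed.

Lemma nrm_le x (r : R) : (`|x| <= r%:C) = (nrm x <= r).
Proof. by rewrite nrmE lecR. Qed.

Lemma nrmD x y : nrm (x + y) <= nrm x + nrm y.
Proof. by rewrite -lecR rmorphD /= -!nrmE ler_normD. Qed.

Lemma nrmN x : nrm (- x) = nrm x.
Proof. by rewrite /nrm normrN. Qed.

Lemma nrmB x y : nrm (x - y) <= nrm x + nrm y.
Proof. by rewrite -(nrmN y) nrmD. Qed.

Lemma nrm_distC x y : nrm (x - y) = nrm (y - x).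
Proof. by rewrite /nrm distrC. Qed.

Lemma nrm_tri y x z : nrm (x - z) <= nrm (x - y) + nrm (y - z).
Proof. by rewrite -lecR rmorphD /= -!nrmE ler_distD. Qed.

Lemma nrm0 : nrm (0 : V) = 0.
Proof. by rewrite /nrm normr0. Qed.

Lemma nrm_eq0 x : nrm x = 0 -> x = 0.
Proof. by move=> x0; apply/eqP; rewrite -normr_eq0 nrmE x0. Qed.

Lemma nrm_eq0_cvg x (e : nat -> R) :
  e @ \oo --> (0 : R) -> (forall n, nrm x <= e n) -> x = 0.
Proof.
move=> e0 xe; apply: nrm_eq0; apply/eqP; rewrite eq_le nrm_ge0 andbT.
have /(_ _)/= := @cvgr_to_ge _ _ _ _ _ _ _ e0.
by apply; apply: nearW.
Qed.

Lemma nrm_sum (I : Type) (s : seq I) (P : pred I) (F : I -> V) :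
  nrm (\sum_(i <- s | P i) F i) <= \sum_(i <- s | P i) nrm (F i).
Proof.
elim/big_rec2 : _ => [|i y1 y2 _ le12]; first by rewrite nrm0.
by apply: le_trans (nrmD _ _) _; rewrite lerD2l.
Qed.

End nrm.

Lemma nrmZ (R : realType) (V : normedModType R[i]) (c : R[i]) (x : V) :
  nrm (c *: x) = nrm c * nrm x.
Proof. by apply: complexI; rewrite rmorphM/= -!nrmE normrZ. Qed.

Lemma nrmZr (R : realType) (V : normedModType R[i]) (r : R) (x : V) :
  0 <= r -> nrm (r%:C *: x) = r * nrm x.
Proof. by move=> r0; rewrite nrmZ {1}/nrm ger0_norm// ler0c. Qed.

Lemma nrmM (R : realType) (c d : R[i]) : nrm (c * d) = nrm c * nrm d.
Proof. by apply: complexI; rewrite rmorphM/= -!nrmE normrM. Qed.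

Lemma nrm_cvgP (R : realType) (V : normedModType R[i]) (T : Type)
    (F : set_system T) (FF : Filter F) (f : T -> V) (l : V) :
  f @ F --> l <-> forall e : R, 0 < e -> \forall t \near F, nrm (f t - l) <= e.
Proof.
split=> [/cvgrPdist_le fl e e0|fl].
  have := fl e%:C; rewrite ltcR => /(_ e0); apply: filterS => t.
  by rewrite distrC nrm_le.
apply/cvgrPdist_le => e e0.
have eE : e = (complex.Re e)%:C by rewrite RRe_real// gtr0_real.
have : 0 < complex.Re e by rewrite -ltcR -eE.
by move=> /fl; apply: filterS => t; rewrite eE distrC nrm_le.
Qed.

(** The limit comes with the rate of the Cauchy estimate, so that its properties
    can be read off from the approximants by norm inequalities alone. *)
Lemma complete_limit (R : realType) (V : completeNormedModType R[i])
    (u : nat -> V) (e : nat -> R) :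
  e @ \oo --> (0 : R) ->
  (forall n m, (n <= m)%N -> nrm (u m - u n) <= e n) ->
  exists l, forall n, nrm (l - u n) <= e n.
Proof.
move=> e0 ue.
have : cvg (u @ \oo).
  apply/cauchy_cvgP/cauchy_ballP => d d0.
  have dE : d = (complex.Re d)%:C by rewrite RRe_real// gtr0_real.
  have dr0 : 0 < complex.Re d by rewrite -ltcR -dE.
  have /cvgrPdist_lt/(_ (complex.Re d / 2)) := e0.
  rewrite divr_gt0// => /(_ isT)[N _ eN].
  have uNd n : (N <= n)%N -> nrm (u n - u N) < complex.Re d / 2.
    move=> Nn; apply: le_lt_trans (ue _ _ Nn) _.
    have := eN N (leqnn N); rewrite /= sub0r normrN.
    exact/le_lt_trans/ler_norm.
  have tail : (u @ \oo) [set x | exists2 n, (N <= n)%N & x = u n].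
    by exists N => // n /= Nn; exists n.
  exists ([set x | exists2 n, (N <= n)%N & x = u n],
          [set x | exists2 n, (N <= n)%N & x = u n]) => //.
  move=> [_ _] [/= [n Nn ->] [m Nm ->]]; rewrite -ball_normE/= dE nrmE ltcR.
  have := nrm_tri (u N) (u n) (u m); rewrite (nrm_distC (u N)).
  have := uNd _ Nn; have := uNd _ Nm; lra.
move=> /cvg_ex[l ul]; exists l => n.
apply/ler_addgt0Pr => d d0.
have /nrm_cvgP/(_ d d0)[N _ uN] := ul.
have := uN (maxn N n) (leq_maxl _ _) => /= uN'.
have := ue n _ (leq_maxr N n).
have := nrm_tri (u (maxn N n)) l (u n); rewrite (nrm_distC l (u (maxn N n))).
by move: uN'; lra.
Qed.

(** * *-homomorphisms are contractive *)

Section cstar.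
Context (R : realType) (A : cstarAlgType R).
Implicit Types x y h : A.

Lemma cmul0l x : cmul 0 x = 0 :> A.
Proof. by have := cscalerAl 0 x x; rewrite !scale0r. Qed.

Lemma cmul0r x : cmul x 0 = 0 :> A.
Proof. by have := cscalerAr 0 x x; rewrite !scale0r. Qed.

Lemma cmulNl x y : cmul (- x) y = - cmul x y.
Proof. by rewrite -scaleN1r cscalerAl scaleN1r. Qed.

Lemma cmulNr x y : cmul x (- y) = - cmul x y.
Proof. by rewrite -scaleN1r cscalerAr scaleN1r. Qed.

Lemma cmulBl x y z : cmul (x - y) z = cmul x z - cmul y z.
Proof. by rewrite cmulDl cmulNl. Qed.

Lemma cmulBr x y z : cmul x (y - z) = cmul x y - cmul x z.
Proof. by rewrite cmulDr cmulNr. Qed.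

Lemma nrm_cmul x y : nrm (cmul x y) <= nrm x * nrm y.
Proof. by rewrite -lecR rmorphM /= -!nrmE cnormM_le. Qed.

Lemma nrm_star x : nrm (cmul (cstar x) x) = nrm x ^+ 2.
Proof. by apply: complexI; rewrite rmorphXn/= -!nrmE cnorm_star. Qed.

Lemma cstarN x : cstar (- x) = - cstar x.
Proof. by rewrite -scaleN1r cstarZ rmorphN1 scaleN1r. Qed.

Lemma cstar0 : cstar 0 = 0 :> A.
Proof. by have := cstarZ 0 (0 : A); rewrite conjC0 !scale0r. Qed.

Lemma cstarB x y : cstar (x - y) = cstar x - cstar y.
Proof. by rewrite cstarD cstarN. Qed.

Lemma nrm_cstar x : nrm (cstar x) = nrm x.
Proof.
have le y : nrm y <= nrm (cstar y).
  have := nrm_cmul (cstar y) y; rewrite nrm_star expr2.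
  have := nrm_ge0 y; rewrite le_eqVlt => /predU1P[<-|y0]; first by rewrite nrm_ge0.
  by rewrite ler_pM2r.
by apply/eqP; rewrite eq_le le -{2}(cstarK x) le.
Qed.

(** In the unitization the last hypothesis reads h^2 + (1 - y)^2 = 1, so that
    u = h + i(1 - y) is unitary, its adjoint is u' = h - i(1 - y), and
    h = (u + u')/2 has norm at most 1.  The unitaries u and u' are only used
    through the isometries v |-> u v and v |-> u' v of A, so no unit has to be
    adjoined. *)
Lemma selfadjoint_le1 h y : cstar h = h -> cstar y = y ->
  cmul h y = cmul y h -> cmul h h + cmul y y = y + y -> nrm h <= 1.
Proof.
move=> hs ys hy e.
(* c is i or -i *)
have isom (c : R[i]) v : c^* = - c -> c * c = -1 ->
    nrm (cmul h v + c *: (v - cmul y v)) = nrm v.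
  move=> cJ cc; apply/eqP; rewrite -(@eqrXn2 _ 2)// ?nrm_ge0//; apply/eqP.
  rewrite -!nrm_star; congr nrm.
  rewrite cstarD cstarZ cstarB !cstarM hs ys cJ.
  set w := cstar v.
  have -> : cmul (cmul w h + - c *: (w - cmul w y)) (cmul h v + c *: (v - cmul y v))
    = cmul w v + cmul w (cmul (cmul h h + cmul y y - (y + y)) v)
      + c *: cmul w (cmul (cmul y h - cmul h y) v).
    rewrite !(cmulDl, cmulDr, cmulNl, cmulNr, cscalerAl, cscalerAr) !cmulA.
    rewrite !(scalerDr, scalerN, scaleNr, scalerA) cc !scaleN1r.
    rewrite !(opprD, opprK) [c *: cmul (cmul w h) v - _]addrC.
    rewrite !addrA addrK.
    rewrite !mulNr cc opprK !scale1r.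
    by rewrite [LHS](ACl (4 * 1 * 7 * 5 * 6 * 3 * 2)%AC).
  by rewrite e hy !subrr !cmul0l !cmul0r scaler0 !addr0.
have hle v : nrm (cmul h v) <= nrm v.
  have := nrmD (cmul h v + 'i *: (v - cmul y v)) (cmul h v + (- 'i) *: (v - cmul y v)).
  rewrite addrACA scaleNr subrr addr0 -scaleNr -mulr2n -scaler_nat !isom//.
  - by rewrite -(rmorph_nat (real_complex R)) nrmZr//; lra.
  - by rewrite rmorphN /= conjCi.
  - by rewrite mulrNN -expr2 sqrCi.
  - by rewrite conjCi.
  - by rewrite -expr2 sqrCi.
have := hle h; rewrite -{1}hs nrm_star.
have := nrm_ge0 h; nra.
Qed.

(** The element is y = 1 - sqrt (1 - h^2), obtained as the fixed point of
    y |-> (h^2 + y^2)/2.  This map contracts the ball of radius r = nrm h by the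
    factor r, and its iterates from 0 are polynomials in h, hence self-adjoint and
    commuting with h. *)
Lemma selfadjoint_root h : cstar h = h -> nrm h < 1 ->
  exists y : A, [/\ cstar y = y, cmul h y = cmul y h
    & cmul h h + cmul y y = y + y].
Proof.
move=> hs h1; set r := nrm h; have r0 : 0 <= r := nrm_ge0 h.
pose half : R[i] := (2^-1)%:C.
have halfJ : half^* = half by exact: conjc_real.
have half0 : 0 <= 2^-1 :> R by lra.
pose g y := half *: (cmul h h + cmul y y).
pose u n := iter n g 0.
have uS n : u n.+1 = g (u n) by [].
have us n : cstar (u n) = u n.
  elim: n => [|n IH]; first exact: cstar0.
  by rewrite uS /g cstarZ cstarD !cstarM hs IH halfJ.
have uh n : cmul h (u n) = cmul (u n) h.
  elim: n => [|n IH]; first by rewrite cmul0l cmul0r.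
  rewrite uS /g cscalerAl cscalerAr cmulDl cmulDr !cmulA IH.
  by rewrite -[cmul (cmul (u n) h) _]cmulA IH cmulA.
have ur n : nrm (u n) <= r.
  elim: n => [|n IH]; first by rewrite nrm0.
  rewrite uS /g nrmZr//.
  have := nrmD (cmul h h) (cmul (u n) (u n)).
  have := nrm_cmul h h; have := nrm_cmul (u n) (u n).
  have := nrm_ge0 (u n); rewrite -/r; nra.
have gB x y : nrm x <= r -> nrm y <= r -> nrm (g x - g y) <= r * nrm (x - y).
  move=> xr yr; rewrite /g -scalerBr opprD addrACA subrr add0r nrmZr//.
  have -> : cmul x x - cmul y y = cmul x (x - y) + cmul (x - y) y.
    by rewrite cmulBl cmulBr addrA subrK.
  have := nrmD (cmul x (x - y)) (cmul (x - y) y).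
  have := nrm_cmul x (x - y); have := nrm_cmul (x - y) y.
  have := nrm_ge0 (x - y); nra.
have uC n m : (n <= m)%N -> nrm (u m - u n) <= r ^+ n.
  elim: n m => [|n IH] [|m]//; try by rewrite subrr nrm0 expr0.
    move=> _; rewrite subr0 expr0 (le_trans (ur _))// ltW//.
  rewrite ltnS => /IH le; rewrite !uS (le_trans (gB _ _ _ _))//.
  by rewrite exprS ler_wpM2l.
have rn0 : (r ^+ n @[n --> \oo] --> (0 : R)) by apply: cvg_expr; rewrite ger0_norm.
have [y yu] := complete_limit rn0 uC.
have cr (c : R) : ((fun n => c * r ^+ n) @ \oo --> (0 : R)).
  by rewrite -[X in _ --> X](mulr0 c); apply: cvgM => //; exact: cvg_cst.
exists y; split.
- apply/eqP; rewrite -subr_eq0; apply/eqP; apply: (nrm_eq0_cvg (cr 2)) => n.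
  have := nrm_tri (cstar (u n)) (cstar y) y.
  by rewrite -cstarB nrm_cstar us (nrm_distC (u n)); have := yu n; lra.
- apply/eqP; rewrite -subr_eq0; apply/eqP; apply: (nrm_eq0_cvg (cr (2 * r))) => n.
  have -> : cmul h y - cmul y h = cmul h (y - u n) - cmul (y - u n) h.
    by rewrite cmulBl cmulBr uh opprB addrA subrK.
  have := nrmB (cmul h (y - u n)) (cmul (y - u n) h).
  have := nrm_cmul h (y - u n); have := nrm_cmul (y - u n) h.
  have := yu n; rewrite -/r; nra.
have yr : nrm y <= r.
  apply/ler_addgt0Pr => d d0.
  have /cvgrPdist_le/(_ d d0)[N _ /(_ N (leqnn N))/=] := rn0.
  rewrite sub0r normrN => /(le_trans (ler_norm _)).
  have := yu N; have := ur N; have := nrmD (y - u N) (u N); rewrite subrK; lra.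
have yg : y = g y.
  apply/eqP; rewrite -subr_eq0; apply/eqP; apply: (nrm_eq0_cvg (cr (2 * r))) => n.
  have := nrm_tri (u n.+1) y (g y); have := gB _ _ (ur n) yr.
  rewrite -uS (nrm_distC (u n)); have := yu n; have := yu n.+1.
  by rewrite exprS; nra.
rewrite [in RHS]yg /g -scalerDl -rmorphD /=.
by rewrite (_ : 2^-1 + 2^-1 = 1) ?scale1r//; lra.
Qed.

(** For self-adjoint h of norm less than 1, f maps the root y of the lemma above
    to a root for f h, which bounds the norm of f h by 1 without any spectral
    theory.  The general case follows from the C*-identity. *)
Lemma hom_contractive (f : A -> A) :
  (forall (c : R[i]) (x y : A), f (c *: x + y) = c *: f x + f y) ->
  (forall x y : A, f (cmul x y) = cmul (f x) (f y)) ->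
  (forall x : A, f (cstar x) = cstar (f x)) ->
  forall x, nrm (f x) <= nrm x.
Proof.
move=> fL fM fS.
have fD x y : f (x + y) = f x + f y by have := fL 1 x y; rewrite !scale1r.
have f0 : f 0 = 0 by apply: (addrI (f 0)); rewrite -fD !addr0.
have fZ c x : f (c *: x) = c *: f x by have := fL c x 0; rewrite f0 !addr0.
have small h : cstar h = h -> nrm h < 1 -> nrm (f h) <= 1.
  move=> hs /(selfadjoint_root hs)[y [ys hy e]].
  by apply: (@selfadjoint_le1 _ (f y)); rewrite -?fS ?hs ?ys -?fM ?hy -?fD ?e.
have sa h : cstar h = h -> nrm (f h) <= nrm h.
  move=> hs; rewrite leNgt; apply/negP => lt.
  have [c1 c2] := midf_lt lt; move: c1 c2; set c := _ / 2 => c1 c2.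
  have c0 : 0 < c by exact: le_lt_trans (nrm_ge0 _) c1.
  have ci0 : 0 <= c^-1 by rewrite invr_ge0 ltW.
  have := small ((c^-1)%:C *: h); rewrite cstarZ hs fZ !nrmZr//.
  have -> : ((c^-1)%:C)^* = (c^-1)%:C :> R[i] by exact: conjc_real.
  move=> /(_ erefl); rewrite !(mulrC c^-1) ltr_pdivrMr// ler_pdivrMr// !mul1r.
  by move=> /(_ c1); rewrite leNgt c2.
move=> x; rewrite -(@ler_pXn2r _ 2) ?nnegrE ?nrm_ge0// -!nrm_star.
by rewrite -fS -fM; apply: sa; rewrite cstarM cstarK.
Qed.

End cstar.
(** * The Bochner integral on a probability space *)

Section bochner_theory.
Context (R : realType) (V : completeNormedModType R[i]).
Context (d : measure_display) (X : measurableType d).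
Variable mu : {measure set X -> \bar R}.
Hypothesis mu1 : mu setT = 1%E.
Implicit Types (f g h : X -> V) (s t : X -> V) (I J : V).

Let m (E : set X) : R := fine (mu E).

Let mE E : measurable E -> mu E = (m E)%:E.
Proof.
move=> mE; rewrite fineK// ge0_fin_numE//.
apply: (@le_lt_trans _ _ 1%E); last exact: ltry.
rewrite -mu1; apply: le_measure; [exact: mem_set|exact: mem_set|exact: subsetT].
Qed.

Lemma prob_simple s :
  finite_set (range s) -> (forall v, measurable (s @^-1` [set v])) ->
  is_simple mu s.
Proof. by move=> sf sm; split=> // v _; rewrite mE ?ltry. Qed.

Section refinement.
Context (W : choiceType) (t : X -> W) (phi : W -> V).
Hypothesis tfin : finite_set (range t).
Hypothesis tmeas : forall w, measurable (t @^-1` [set w]).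

Lemma range_comp_finite : finite_set (range (phi \o t)).
Proof.
apply: (@sub_finite_set _ _ (phi @` range t)); last exact: finite_image.
by move=> _ [x _ <-]; exists (t x) => //; exists x.
Qed.

Lemma preimage_comp_fiber (Y : set V) :
  (phi \o t) @^-1` Y = \bigcup_(w in range t `&` phi @^-1` Y) t @^-1` [set w].
Proof.
apply/seteqP; split=> [x /= Yx|x [w [_ /= Yw] /= tx]]; last by rewrite /= tx.
by exists (t x) => //; split => //; exists x.
Qed.

Lemma comp_simple : is_simple mu (phi \o t).
Proof.
apply: prob_simple; first exact: range_comp_finite.
move=> v; rewrite preimage_comp_fiber; apply: fin_bigcup_measurable => //.
exact: finite_setIl.
Qed.

Lemma measure_fiber v : m ((phi \o t) @^-1` [set v]) =
  \sum_(w \in range t) (if phi w == v then m (t @^-1` [set w]) else 0).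
Proof.
pose F w := if phi w == v then t @^-1` [set w] else set0.
have Fm w : measurable (F w) by rewrite /F; case: ifP.
have -> : (phi \o t) @^-1` [set v] = \bigcup_(w in range t) F w.
  apply/seteqP; split=> [x /= tx|x [w _]]; last first.
    by rewrite /F; case: eqP => // <- /= <-.
  by exists (t x); [exists x|rewrite /F tx eqxx].
rewrite /m measure_fin_bigcup//; last first.
  move=> i j _ _ [x []]; rewrite /F.
  by do 2 (case: ifP => // _); move=> /= <- <-.
rewrite (eq_fsbigr (fun w => (if phi w == v then m (t @^-1` [set w]) else 0)%:E)).
  by rewrite fsumEFin.
by move=> w _; rewrite /F; case: ifP => _; [exact: mE|exact: measure0].
Qed.

(** Computing the integral of a simple function from a finer partition is what
    makes it linear: two simple functions have a common refinement. *)
Lemma simple_integral_comp : simple_integral mu (phi \o t) =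
  \sum_(w \in range t) (m (t @^-1` [set w]))%:C *: phi w.
Proof.
have pfin := range_comp_finite.
rewrite /simple_integral; under eq_fsbigr do rewrite -/(m _) measure_fiber.
transitivity (\sum_(v \in range (phi \o t)) \sum_(w \in range t)
   (if phi w == v then m (t @^-1` [set w]) else 0)%:C *: v).
  by apply: eq_fsbigr => v _; rewrite !fsbig_finite//= rmorph_sum scaler_suml.
rewrite exchange_fsbig//; apply: eq_fsbigr => w /set_mem [x _ <-].
rewrite (fsbigD1 (phi (t x)))//=; last by exists x.
by rewrite eqxx fsbig1 ?addr0// => v [_ /eqP]; rewrite eq_sym => /negbTE->; rewrite scale0r.
Qed.

End refinement.

Section common_refinement.
Variables s t : X -> V.
Hypotheses (ss : is_simple mu s) (ts : is_simple mu t).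

Lemma pair_finite : finite_set (range (fun x => (s x, t x))).
Proof.
case: ss ts => [sf _ _] [tf _ _].
apply: sub_finite_set (finite_setX sf tf).
by move=> _ [x _ <-]; split; exists x.
Qed.

Lemma pair_measurable w : measurable ((fun x => (s x, t x)) @^-1` [set w]).
Proof.
case: ss ts => [_ sm _] [_ tm _].
rewrite (_ : _ @^-1` _ = s @^-1` [set w.1] `&` t @^-1` [set w.2]).
  exact: measurableI.
by apply/seteqP; split=> x /=; [move=> <-|move=> [-> ->]; case: w].
Qed.

Lemma linear_simple (c : R[i]) : is_simple mu (fun x => c *: s x + t x).
Proof.
exact: (comp_simple (fun w => c *: w.1 + w.2) pair_finite pair_measurable).
Qed.

Lemma simple_integral_linear (c : R[i]) :
  simple_integral mu (fun x => c *: s x + t x) =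
  c *: simple_integral mu s + simple_integral mu t.
Proof.
have E phi := simple_integral_comp phi pair_finite pair_measurable.
rewrite (E (fun w => c *: w.1 + w.2)) (E fst) (E snd).
have fin := pair_finite.
rewrite !fsbig_finite// scaler_sumr -big_split/=; apply: eq_bigr => w _.
by rewrite scalerDr !scalerA mulrC.
Qed.

End common_refinement.

Lemma measurable_simple_dep s (g : V -> X -> R) : is_simple mu s ->
  (forall v, measurable_fun setT (g v)) ->
  measurable_fun setT (fun x => g (s x) x).
Proof.
move=> [sf sm _] gm _ Y mY; rewrite setTI.
rewrite (_ : _ @^-1` _ = \bigcup_(v in range s) (s @^-1` [set v] `&` g v @^-1` Y)).
  apply: fin_bigcup_measurable => // v _; apply: measurableI => //.
  by rewrite -[X in measurable X]setTI; exact: gm.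
apply/seteqP; split=> [x /= Yx|x [v _ [/= -> ]]//].
by exists (s x) => //; exists x.
Qed.

Lemma measurable_nrm_simple s : is_simple mu s ->
  measurable_fun setT (fun x => nrm (s x)).
Proof. by move=> ss; apply: (@measurable_simple_dep s (fun v _ => nrm v)). Qed.

Lemma integral_nrm_simple s : is_simple mu s ->
  (\int[mu]_x (nrm (s x))%:E)%E =
  (\sum_(v \in range s) m (s @^-1` [set v]) * nrm v)%:E.
Proof.
move=> ss; have [sf sm _] := ss.
transitivity (\int[mu]_x (\sum_(v \in range s) (nrm v * \1_(s @^-1` [set v]) x)%:E)%R)%E.
  apply: eq_integral => x _; rewrite (fsbigD1 (s x))//=; last by exists x.
  rewrite fsbig1 ?adde0; first by rewrite indicE mem_set// mulr1.
  move=> v [_ /= vs]; rewrite indicE memNset ?mulr0//.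
  by move=> /= sv; apply: vs.
rewrite ge0_integral_fsum//; last 2 first.
- by move=> v; apply/measurable_EFinP; apply: measurable_funM => //; exact: measurable_indic.
- by move=> v x _; rewrite lee_fin mulr_ge0 ?nrm_ge0.
rewrite -fsumEFin//; apply: eq_fsbigr => v _.
under eq_integral do rewrite EFinM.
rewrite ge0_integralZl_EFin ?nrm_ge0//.
  by rewrite integral_indic// setIT mE// -EFinM mulrC.
by apply/measurable_EFinP; exact: measurable_indic.
Qed.

Lemma nrm_simple_integral s : is_simple mu s ->
  ((nrm (simple_integral mu s))%:E <= \int[mu]_x (nrm (s x))%:E)%E.
Proof.
move=> ss; have [sf sm _] := ss.
rewrite integral_nrm_simple// lee_fin /simple_integral !fsbig_finite//=.
apply: le_trans (nrm_sum _ _ _) _; apply: ler_sum => v _.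
by rewrite nrmZr// fine_ge0.
Qed.

Lemma integral_le_cst (h : X -> R) (c : R) : measurable_fun setT h ->
  (forall x, 0 <= h x) -> (forall x, h x <= c) ->
  (\int[mu]_x (h x)%:E <= c%:E)%E.
Proof.
move=> mh h0 hc.
have -> : c%:E = (\int[mu]_x (cst c%:E) x)%E.
  by rewrite integral_cst// mu1 mule1.
by apply: ge0_le_integral => //; [move=> x _; rewrite lee_fin|
  exact/measurable_EFinP|move=> x _; rewrite lee_fin].
Qed.

(** Working up to an arbitrary e instead of along sequences makes the estimates
    below finite computations with one simple function. *)
Lemma bochner_approxP f I : is_bochner_integral mu f I <->
  forall e : R, 0 < e -> exists s, [/\ is_simple mu s,
    measurable_fun setT (fun x => nrm (f x - s x)),
    (\int[mu]_x (nrm (f x - s x))%:E <= e%:E)%E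
    & nrm (simple_integral mu s - I) <= e].
Proof.
split=> [[s [ss sm s0 sI]] e e0|H].
  have /nrm_cvgP/(_ e e0) nI := sI.
  have nint : \forall i \near \oo, (\int[mu]_x (nrm (f x - s i x))%:E < e%:E)%E.
    by apply: (s0 _ (open_ereal_lt' _)); rewrite lte_fin.
  have [N _ H] := filterI nI nint; have [nI_N nint_N] := H N (leqnn N).
  by exists (s N); split; [exact: ss|exact: sm|exact: ltW|].
have /choice[s sP] (i : nat) : exists s, [/\ is_simple mu s,
    measurable_fun setT (fun x => nrm (f x - s x)),
    (\int[mu]_x (nrm (f x - s x))%:E <= (i.+1%:R^-1)%:E)%E
    & nrm (simple_integral mu s - I) <= i.+1%:R^-1].
  by apply: H; rewrite invr_gt0.
exists s; split; [by move=> i; case: (sP i)|by move=> i; case: (sP i)| |].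
  apply: (@squeeze_cvge _ _ _ _ (cst 0%E) _ (fun i => (i.+1%:R^-1)%:E)).
  - apply: nearW => i; case: (sP i) => _ _ -> _; rewrite andbT.
    by apply: integral_ge0 => x _; rewrite lee_fin nrm_ge0.
  - exact: cvg_cst.
  - by apply: cvg_EFin; [exact: nearW|exact: cvg_harmonic].
apply/nrm_cvgP => e e0.
have /cvgrPdist_le/(_ e e0) := @cvg_harmonic R.
apply: filterS => i; rewrite sub0r normrN ger0_norm ?invr_ge0// => le.
by case: (sP i) => _ _ _ /le_trans; exact.
Qed.

Lemma integral_nrm_triangle f g h :
  measurable_fun setT (fun x => nrm (f x)) ->
  measurable_fun setT (fun x => nrm (g x)) ->
  measurable_fun setT (fun x => nrm (h x)) ->
  (forall x, nrm (f x) <= nrm (g x) + nrm (h x)) ->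
  (\int[mu]_x (nrm (f x))%:E <=
   \int[mu]_x (nrm (g x))%:E + \int[mu]_x (nrm (h x))%:E)%E.
Proof.
move=> mf mg mh fgh.
rewrite -ge0_integralD//; try (by move=> x _; rewrite lee_fin nrm_ge0);
  try exact/measurable_EFinP.
apply: ge0_le_integral => //.
- by move=> x _; rewrite lee_fin nrm_ge0.
- exact/measurable_EFinP.
- by apply: emeasurable_funD; exact/measurable_EFinP.
- by move=> x _; rewrite lee_fin.
Qed.

(** Measurability of the distances to points implies that of the distances to
    simple functions.  When V is not separable, a sum of two functions with this
    property need not have it, so linearity below assumes it of the sum. *)
Definition dist_measurable f :=
  forall v, measurable_fun setT (fun x => nrm (f x - v)).

Lemma dist_measurable_simple f s : dist_measurable f -> is_simple mu s ->
  measurable_fun setT (fun x => nrm (f x - s x)).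
Proof. by move=> fm ss; apply: (@measurable_simple_dep s (fun v x => nrm (f x - v))). Qed.

Lemma dist_measurable_nrm f : dist_measurable f ->
  measurable_fun setT (fun x => nrm (f x)).
Proof. by move=> /(_ 0); under eq_fun do rewrite subr0. Qed.

Lemma nrm_bochner_integral f I : dist_measurable f -> is_bochner_integral mu f I ->
  ((nrm I)%:E <= \int[mu]_x (nrm (f x))%:E)%E.
Proof.
move=> fm /bochner_approxP H; apply/lee_addgt0Pr => e e0.
have [s [ss sm se sI]] := H (e / 2) (divr_gt0 e0 (ltr0n _ 2)).
have sb := nrm_simple_integral ss.
have tri : (\int[mu]_x (nrm (s x))%:E <= \int[mu]_x (nrm (f x))%:E +
    \int[mu]_x (nrm (f x - s x))%:E)%E.
  apply: (@integral_nrm_triangle s f (fun x => f x - s x)) => //.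
  - exact: measurable_nrm_simple.
  - exact: dist_measurable_nrm.
  - by move=> x; have := nrmB (f x) (f x - s x); rewrite opprB addrC subrK.
have Is : nrm I <= nrm (simple_integral mu s) + e / 2.
  have := nrmB (simple_integral mu s) (simple_integral mu s - I).
  by rewrite opprB addrC subrK; lra.
apply: (@le_trans _ _ (nrm (simple_integral mu s) + e / 2)%:E).
  by rewrite lee_fin.
rewrite EFinD [e in leRHS]splitr EFinD addeA leeD2r//.
by apply: (le_trans sb); apply: (le_trans tri); rewrite leeD2l.
Qed.

Lemma bochner_integral_linear (c : R[i]) f g I J :
  dist_measurable (fun x => c *: f x + g x) ->
  is_bochner_integral mu f I -> is_bochner_integral mu g J ->
  is_bochner_integral mu (fun x => c *: f x + g x) (c *: I + J).
Proof.
move=> fgm /bochner_approxP Hf /bochner_approxP Hg; apply/bochner_approxP => e e0.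
set k := nrm c; have k0 : 0 <= k := nrm_ge0 c.
(* k + 1 rather than k, which may vanish *)
have e'0 : 0 < e / (k + 1) by rewrite divr_gt0// ltr_wpDl.
have e'E : k * (e / (k + 1)) + e / (k + 1) = e.
  by rewrite -{2}[e / _]mul1r -mulrDl mulrC divfK// gt_eqF// ltr_wpDl.
have [s [ss sm se sI]] := Hf _ e'0; have [t [ts tm te tJ]] := Hg _ e'0.
have sts := linear_simple ss ts c.
exists (fun x => c *: s x + t x); split => //.
- exact: dist_measurable_simple.
- rewrite -[X in (_ <= X%:E)%E]e'E EFinD EFinM.
  have mc : measurable_fun setT (fun x => nrm (c *: (f x - s x))).
    by under eq_fun do rewrite nrmZ; exact: measurable_funM.
  apply: (@le_trans _ _ (\int[mu]_x (nrm (c *: (f x - s x)))%:E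
      + \int[mu]_x (nrm (g x - t x))%:E)%E).
    apply: (@integral_nrm_triangle (fun x => c *: f x + g x - (c *: s x + t x))
      (fun x => c *: (f x - s x)) (fun x => g x - t x)) => //.
      exact: dist_measurable_simple.
    by move=> x; rewrite opprD addrACA -scalerBr nrmD.
  apply: leeD => //; under eq_integral do rewrite nrmZ EFinM.
  rewrite ge0_integralZl_EFin//; first by rewrite lee_wpmul2l// lee_fin.
    by move=> x _; rewrite lee_fin nrm_ge0.
  exact/measurable_EFinP.
- rewrite simple_integral_linear// opprD addrACA -scalerBr.
  apply: (le_trans (nrmD _ _)); rewrite nrmZ -/k -[leRHS]e'E lerD//.
  by rewrite ler_wpM2l.
Qed.

(** The difference of two integrals of f is an integral of the zero function. *)
Lemma bochner_integral_unique f I J :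
  is_bochner_integral mu f I -> is_bochner_integral mu f J -> I = J.
Proof.
move=> fI fJ; apply/eqP; rewrite -subr_eq0; apply/eqP.
have zm : dist_measurable (fun x => -1 *: f x + f x).
  by move=> v; under eq_fun do rewrite scaleN1r addNr; exact: measurable_cst.
have := nrm_bochner_integral zm (bochner_integral_linear zm fJ fI).
under eq_integral do rewrite scaleN1r addNr nrm0.
rewrite integral0 lee_fin scaleN1r addrC => le; apply: nrm_eq0.
by apply/eqP; rewrite eq_le le nrm_ge0.
Qed.

Lemma bochnerE f I : is_bochner_integral mu f I -> bochner mu f = I.
Proof.
move=> fI; rewrite /bochner; case: xgetP => [J _ fJ|/(_ I)//].
exact: bochner_integral_unique fJ fI.
Qed.

(** The integrals of uniform approximants are Cauchy, since on a probability space
    they differ by no more than the approximants do. *)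
Lemma uniform_simple_integrable f : dist_measurable f ->
  (forall e : R, 0 < e -> exists2 s, is_simple mu s & forall x, nrm (f x - s x) <= e) ->
  is_bochner_integral mu f (bochner mu f).
Proof.
move=> fm H; suff [I fI] : exists I, is_bochner_integral mu f I by rewrite (bochnerE fI).
have /choice[s sP] (i : nat) : exists s, is_simple mu s /\
    forall x, nrm (f x - s x) <= i.+1%:R^-1.
  by have [|s ss se] := H i.+1%:R^-1; [rewrite invr_gt0|exists s].
have inv0 : (2 * i.+1%:R^-1 @[i --> \oo] --> (0 : R)).
  by rewrite -[X in _ --> X](mulr0 2); apply: cvgM; [exact: cvg_cst|exact: cvg_harmonic].
have [|I uI] := @complete_limit _ _ (fun i => simple_integral mu (s i)) _ inv0.
  move=> i j ij; have [si sie] := sP i; have [sj sje] := sP j.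
  have := nrm_simple_integral (linear_simple si sj (-1)).
  rewrite simple_integral_linear// scaleN1r addrC -lee_fin => /le_trans; apply.
  apply: integral_le_cst; [|by move=> x; exact: nrm_ge0|move=> x].
    exact: measurable_nrm_simple (linear_simple si sj (-1)).
  rewrite scaleN1r addrC; have := nrm_tri (f x) (s j x) (s i x).
  rewrite (nrm_distC _ (f x)) => /le_trans; apply.
  rewrite mulrDl mul1r lerD//; apply: (le_trans (sje x)).
  by rewrite lef_pV2 ?posrE// ler_nat.
exists I; apply/bochner_approxP => e e0.
have /cvgrPdist_le/(_ e e0)[N _ /(_ N (leqnn N))/=] := inv0.
rewrite sub0r normrN ger0_norm ?mulr_ge0// => Ne.
have [ss se] := sP N.
have inve : N.+1%:R^-1 <= e by apply: le_trans Ne; rewrite ler_peMl// ler1n.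
exists (s N); split => //; first exact: dist_measurable_simple.
  apply: integral_le_cst => [|x|x]; [exact: dist_measurable_simple|exact: nrm_ge0|].
  exact: le_trans inve.
by rewrite nrm_distC (le_trans (uI N)).
Qed.

End bochner_theory.
(** * Continuous functions *)

Section continuity.
Context (R : realType) (V : normedModType R[i]) (U : topologicalType).
Implicit Types f g : U -> V.

Lemma continuous_nrm f : continuous f -> continuous (fun x => nrm (f x)).
Proof.
move=> cf x; apply/cvgrPdist_le => e e0.
have /nrm_cvgP/(_ e e0) := cf x; apply: filterS => y; rewrite ler_norml.
have := nrmD (f y) (f x - f y); have := nrmD (f x) (f y - f x).
rewrite !(addrC _ (_ - _)) !subrK (nrm_distC (f x)); lra.
Qed.

Lemma continuous_dist f v : continuous f -> continuous (fun x => nrm (f x - v)).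
Proof.
by move=> cf; apply: continuous_nrm => x; apply: cvgB; [exact: cf|exact: cvg_cst].
Qed.

Lemma continuous_linear (c : R[i]) f g : continuous f -> continuous g ->
  continuous (fun x => c *: f x + g x).
Proof.
by move=> cf cg x; apply: cvgD; [apply: cvgZr; exact: cf|exact: cg].
Qed.

Lemma continuous_sum (I : Type) (s : seq I) (F : I -> U -> V) :
  (forall i, continuous (F i)) -> continuous (fun x => \sum_(i <- s) F i x).
Proof.
move=> cF x; rewrite /continuous_at; elim: s => [|i s IH].
  by under eq_fun do rewrite big_nil; rewrite big_nil; exact: cvg_cst.
by under eq_fun do rewrite big_cons; rewrite big_cons; apply: cvgD => //; exact: cF.
Qed.

Lemma continuous_scale (h : U -> R[i]^o) f : continuous h -> continuous f ->
  continuous (fun x => h x *: f x).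
Proof. by move=> ch cf x; apply: cvgZ; [exact: ch|exact: cf]. Qed.

End continuity.

(** * The torus *)

Section torus.
Context (R : realType) (k : nat).
Local Notation T := (torus R k).
Local Notation B := (borel_torus R k).

Lemma unit_circle_compact : compact [set z : R[i]^o | `|z| = 1].
Proof.
have box : compact ((fun p : R * R => p.1 +i* p.2 : R[i]^o) @`
    (`[(-1), 1]%classic `*` `[(-1), 1]%classic)).
  apply: continuous_compact; last by apply: compact_setX; exact: segment_compact.
  apply: continuous_subspaceT => -[a b]; apply/nrm_cvgP => e e0.
  have e2 : 0 < e / 2 by rewrite divr_gt0.
  exists (ball a (e / 2), ball b (e / 2)).
    by split; exact: nbhsx_ballx.
  move=> p []; rewrite /ball /= => pa pb.
  rewrite (_ : _ - _ = (p.1 - a)%:C + 'i%C * (p.2 - b)%:C :> R[i]); last first.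
    by apply/eqP; rewrite eq_complex /= !(mul0r, mul1r, mulr0, subr0, addr0, add0r) !eqxx.
  apply: (le_trans (nrmD _ _)).
  have nC (r : R) : nrm (r%:C : R[i]) = `|r|.
    by apply: complexI; rewrite -nrmE normc_def /= expr0n addr0 sqrtr_sqr.
  rewrite nrmM !nC [nrm 'i%C](_ : _ = 1); last first.
    by rewrite /nrm normc_def /= expr0n add0r expr1n sqrtr1.
  by rewrite mul1r [e]splitr lerD// ltW// distrC.
rewrite (_ : mkset _ = ((fun p : R * R => p.1 +i* p.2 : R[i]^o) @`
    (`[(-1), 1]%classic `*` `[(-1), 1]%classic)) `&` [set z : R[i]^o | `|z| = 1]).
  apply: compact_closedI => //.
  apply: (@closed_comp _ _ (fun z : R[i]^o => `|z| : R[i]^o) [set 1]).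
    by move=> z _; exact: norm_continuous.
  exact: (accessible_closed_set1 (hausdorff_accessible (@norm_hausdorff _ R[i]^o))).
apply/seteqP; split=> [z /= z1|z []//]; split => //.
have : complex.Re z ^+ 2 + complex.Im z ^+ 2 = 1.
  by apply: complexI; rewrite add_Re2_Im2 z1 expr1n.
case: z {z1} => a b /= ab; exists (a, b) => //.
by split; rewrite /= in_itv /=; apply/andP; split; nra.
Qed.

Lemma torus_compact : compact [set: T].
Proof.
have KT : compact (torus_set R k).
  have := @rV_compact _ k (fun=> [set z : R[i]^o | `|z| = 1]).
  by apply => _; exact: unit_circle_compact.
move=> F PF _.
have FK : (set_val @ F) (torus_set R k).
  by apply: (@filterS _ F _ setT) => [x _|]; [exact: set_mem (valP x)|exact: filterT].
have [p [Kp clp]] := KT _ _ FK.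
exists (exist _ p (mem_set Kp) : T); split => // P Q FP.
rewrite nbhsE => -[_ [[C oC <-] /= Cp] CQ].
have : (set_val @ F) (set_val @` P).
  by apply: (@filterS _ F _ P) => // x Px; exists x.
move=> /clp /(_ (open_nbhs_nbhs (conj oC Cp))) [_ [[x Px <-] Cx]].
by exists x; split => //; exact: CQ.
Qed.

Lemma continuous_tcoord (j : 'I_k) : continuous (fun z : T => tcoord z j : R[i]^o).
Proof.
move=> z; apply: (@continuous_comp T _ _ set_val (fun v : 'rV[R[i]^o]_k => v ord0 j)).
  exact: initial_continuous.
exact: coord_continuous.
Qed.

Lemma continuous_torus_mul (w : T) : continuous (torus_mul w).
Proof.
apply: (@continuous_comp_initial _ T _ set_val) => z B [P zP PB].
(* neighbourhoods of a matrix are entrywise *)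
have near_ij i j : \forall x \near z, P i j ((set_val (torus_mul w x)) i j).
  have jc : continuous (fun x : T => tcoord w j * tcoord x j : R[i]^o).
    exact: (continuous_scale (@cst_continuous _ _ _) (@continuous_tcoord j)).
  have := jc z (P i j); rewrite /= => /(_ _)/= H.
  have nPij : \forall x \near z, P i j (tcoord w j * tcoord x j).
    by apply: H; have := zP i j; rewrite /= mxE.
  by apply: (@filterS _ (nbhs z) _ _ _ _ nPij) => x; rewrite /= mxE.
have near_all : \forall x \near z, forall i j, P i j (set_val (torus_mul w x) i j).
  have near_row i : \forall x \near z, forall j, P i j (set_val (torus_mul w x) i j).
    exact: (@filter_forall _ _ (fun j x => P i j (set_val (torus_mul w x) i j)) _
      (nbhs_filter z) (near_ij i)).
  exact: (@filter_forall _ _ (fun i x => forall j, P i j (set_val (torus_mul w x) i j))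
    _ (nbhs_filter z) near_row).
by apply: (@filterS _ (nbhs z) _ _ _ _ near_all) => x xP; exact: PB.
Qed.

Lemma open_measurable_torus (U : set T) : open U ->
  measurable (U : set (borel_torus R k)).
Proof. by move=> oU; exact: sub_sigma_algebra. Qed.

Lemma continuous_measurable_torus (h : T -> R) : continuous h ->
  measurable_fun setT (h : borel_torus R k -> R).
Proof.
move=> ch; apply: (measurability _ (RGenOInfty.measurableE R)).
move=> _ [_ [x ->] <-]; rewrite setTI; apply: open_measurable_torus.
by apply: open_comp => // *; exact: ch.
Qed.

Lemma measurable_torus_mul (w : T) :
  measurable_fun setT (torus_mul w : borel_torus R k -> borel_torus R k).
Proof.
apply: (@measurability _ _ B B setT _ (@open T)) => //.
move=> _ [U oU <-]; rewrite setTI; apply: open_measurable_torus.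
by have /continuousP := @continuous_torus_mul w; exact.
Qed.

End torus.

Section torus_integral.
Context (R : realType) (k : nat) (V : completeNormedModType R[i]).
Local Notation T := (torus R k).
Local Notation B := (borel_torus R k).
Variable mu : {measure set B -> \bar R}.
Hypothesis hmu : normalised_haar mu.
Let mu1 : mu setT = 1%E. Proof. by case: hmu. Qed.
Implicit Types f g : T -> V.

Lemma continuous_dist_measurable f : continuous f ->
  dist_measurable (f : B -> V).
Proof.
by move=> cf v; apply: continuous_measurable_torus; exact: continuous_dist.
Qed.

(** By compactness a continuous function is within e of finitely many of its
    values; which of them are close to [f x] is recorded in a finite type, and
    one is picked from that record. *)
Lemma continuous_simple_approx f (e : R) : continuous f -> 0 < e ->
  exists2 s : B -> V, is_simple mu s & forall x, nrm (f x - s x) <= e.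
Proof.
move=> cf e0.
have cover : cover_compact [set: T] by rewrite -compact_cover; exact: torus_compact.
pose ball_f (z0 : T) : set T := [set z | nrm (f z - f z0) < e].
have oball z0 : open (ball_f z0).
  have -> : ball_f z0 = (fun z => nrm (f z - f z0)) @^-1` [set r | r < e] by [].
  apply: open_comp; last exact: open_lt.
  by move=> z _; exact: continuous_dist.
have [|D _ DT] := @cover _ setT ball_f (fun z0 _ => oball z0).
  by move=> z _; exists z => //; rewrite /ball_f /= subrr nrm0.
pose t (z : B) : {ffun D -> bool} := [ffun i => nrm (f z - f (val i)) < e].
pose phi (w : {ffun D -> bool}) : V := if [pick i | w i] is Some i then f (val i) else 0.
exists (phi \o t).
  apply: (comp_simple mu1); first exact: finite_finset.
  move=> w; rewrite (_ : _ @^-1` _ =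
    \bigcap_(i in [set: D]) (if w i then ball_f (val i) else ~` ball_f (val i))).
    apply: fin_bigcap_measurable => // i _.
    case: ifP => _; first exact: open_measurable_torus.
    by apply: measurableC; exact: open_measurable_torus.
  apply/seteqP; split=> [z /= <- i _|z H]; rewrite /t.
    by rewrite ffunE; case: ifPn => // /negP.
  apply/ffunP => i; rewrite ffunE; have := H i I.
  by case: (w i) => //= /negP/negbTE.
move=> z /=; rewrite /phi; case: pickP => [i|none].
  by rewrite ffunE => /ltW.
have [z0 Dz0 zz0] := DT z I.
by have := none [` Dz0]%fset; rewrite ffunE zz0.
Qed.

Lemma continuous_bochner f : continuous f ->
  is_bochner_integral mu (f : B -> V) (bochner mu (f : B -> V)).
Proof.
move=> cf; apply: (uniform_simple_integrable mu1).
  exact: continuous_dist_measurable.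
by move=> e; exact: continuous_simple_approx.
Qed.

Lemma bochner_linear (c : R[i]) f g : continuous f -> continuous g ->
  bochner mu (fun z : B => c *: f z + g z) =
  c *: bochner mu (f : B -> V) + bochner mu (g : B -> V).
Proof.
move=> cf cg; apply: (bochnerE mu1); apply: (bochner_integral_linear mu1).
- by apply: continuous_dist_measurable; exact: continuous_linear.
- exact: continuous_bochner.
- exact: continuous_bochner.
Qed.

Lemma bochner0 : bochner mu (fun _ : B => 0 : V) = 0.
Proof.
have := @bochner_linear 1 (fun=> 0) (fun=> 0).
rewrite !scale1r addr0 => /(_ _ _)/esym H.
by apply: (addrI (bochner mu (fun _ : B => 0 : V))); rewrite addr0 H//; exact: cst_continuous.
Qed.

Lemma bochnerZ (c : R[i]) f : continuous f ->
  bochner mu (fun z : B => c *: f z) = c *: bochner mu (f : B -> V).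
Proof.
move=> cf; have := @bochner_linear c f (fun=> 0) cf (@cst_continuous _ _ _).
rewrite bochner0 addr0 => <-; congr bochner.
by apply/funext => z; rewrite addr0.
Qed.

Lemma bochner_sum (I : Type) (s : seq I) (F : I -> T -> V) :
  (forall i, continuous (F i)) ->
  bochner mu (fun z : B => \sum_(i <- s) F i z) =
  \sum_(i <- s) bochner mu (F i : B -> V).
Proof.
move=> cF; elim: s => [|i s IH].
  by rewrite big_nil -[RHS]bochner0; congr bochner; apply/funext => z; rewrite big_nil.
rewrite big_cons -IH -[bochner mu (F i : B -> V)]scale1r -bochner_linear//;
  last exact: continuous_sum.
by congr bochner; apply/funext => z; rewrite big_cons scale1r.
Qed.

Lemma nrm_bochner_le f : continuous f ->
  ((nrm (bochner mu (f : B -> V)))%:E <= \int[mu]_z (nrm (f z))%:E)%E.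
Proof.
move=> cf; apply: (nrm_bochner_integral mu1); last exact: continuous_bochner.
exact: continuous_dist_measurable.
Qed.

Lemma haar_pushforward (w : T) (E : set B) : measurable E ->
  pushforward mu (torus_mul w : B -> B) E = mu E.
Proof. by case: hmu => _ + mE; apply. Qed.

Lemma integral_translate (w : T) (h : T -> R) : measurable_fun setT (h : B -> R) ->
  (forall z, 0 <= h z) ->
  (\int[mu]_(z in setT) (h (torus_mul w z))%:E = \int[mu]_(z in setT) (h z)%:E)%E.
Proof.
move=> mh h0; have mw := @measurable_torus_mul R k w.
transitivity (\int[pushforward mu (torus_mul w : B -> B)]_z (h z)%:E)%E.
  rewrite (ge0_integral_pushforward mw)//; first exact/measurable_EFinP.
  by move=> z _; rewrite lee_fin.
by apply: eq_measure_integral => E mE _; exact: haar_pushforward.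
Qed.

Lemma simple_translate (w : T) (s : B -> V) : is_simple mu s ->
  is_simple mu (s \o torus_mul w).
Proof.
move=> [sf sm _]; apply: (prob_simple mu1).
  by apply: sub_finite_set sf => _ [z _ <-]; exists (torus_mul w z).
move=> v; have := @measurable_torus_mul R k w measurableT _ (sm v).
by rewrite setTI.
Qed.

Lemma simple_integral_translate (w : T) (s : B -> V) : is_simple mu s ->
  simple_integral mu (s \o torus_mul w) = simple_integral mu s.
Proof.
move=> ss; have [sf sm _] := ss.
rewrite /simple_integral (fsbig_widen _ (range s)).
- apply: eq_fsbigr => v _; rewrite -(haar_pushforward w (sm v)).
  by rewrite /pushforward comp_preimage.
- by move=> _ [z _ <-]; exists (torus_mul w z).
(* a value of s missed by the translate has an empty fibre *)
- move=> v [_ nv] /=.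
  rewrite (_ : _ @^-1` _ = set0) ?measure0 ?scale0r//.
  by apply/seteqP; split => // z /= sz; apply: nv; exists z.
Qed.

Lemma bochner_translate (w : T) f : continuous f ->
  bochner mu (fun z : B => f (torus_mul w z)) = bochner mu (f : B -> V).
Proof.
move=> cf; apply: (bochnerE mu1).
apply/bochner_approxP => e e0.
have /bochner_approxP/(_ e e0)[s [ss sm se sI]] := continuous_bochner cf.
exists (s \o torus_mul w); split.
- exact: simple_translate.
- exact: (measurableT_comp sm (@measurable_torus_mul R k w)).
- by rewrite (integral_translate w (h := fun z => nrm (f z - s z)))// => z; exact: nrm_ge0.
- by rewrite simple_integral_translate.
Qed.

End torus_integral.
(** * Characters of the torus *)

Lemma continuous_Re (R : realType) (U : topologicalType) (h : U -> R[i]^o) :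
  continuous h -> continuous (fun x => complex.Re (h x)).
Proof.
move=> ch x; apply/cvgrPdist_le => e e0.
have /nrm_cvgP/(_ e e0) := ch x; apply: filterS => y.
apply: le_trans; rewrite distrC -lecR -nrmE.
by apply: le_trans (normc_ge_Re _); case: (h x) (h y) => a b [].
Qed.

Section characters.
Context (R : realType) (k : nat).
Local Notation T := (torus R k).
Implicit Types (z w : T) (m n p : Zk k).

Lemma nrm_tcoord z j : `|tcoord z j| = 1.
Proof. exact: (set_mem (valP z) j). Qed.

Lemma tcoord_neq0 z j : tcoord z j != 0.
Proof. by rewrite -normr_eq0 nrm_tcoord oner_eq0. Qed.

Lemma torus_expM w z n : torus_exp (torus_mul w z) n = torus_exp w n * torus_exp z n.
Proof.
rewrite /torus_exp -big_split/=; apply: eq_bigr => j _.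
by rewrite -expfzMl /tcoord /= mxE.
Qed.

Lemma torus_expD z m n : torus_exp z (m + n) = torus_exp z m * torus_exp z n.
Proof.
rewrite /torus_exp -big_split/=; apply: eq_bigr => j _.
by rewrite ffunE expfzDr// tcoord_neq0.
Qed.

Lemma torus_exp0 z : torus_exp z 0 = 1.
Proof. by rewrite /torus_exp big1// => j _; rewrite ffunE. Qed.

Lemma nrm_torus_exp z n : nrm (torus_exp z n) = 1.
Proof.
apply: complexI; rewrite -nrmE /torus_exp normr_prod big1// => j _.
case: (n j) => i; first by rewrite -exprnP normrX nrm_tcoord expr1n.
by rewrite NegzE -exprnN normfV normrX nrm_tcoord expr1n invr1.
Qed.

Lemma continuous_torus_exp n : continuous (fun z : T => torus_exp z n : R[i]^o).
Proof.
have cX i j : continuous (fun z : T => tcoord z j ^+ i : R[i]^o).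
  elim: i => [|i IH]; first exact: cst_continuous.
  under eq_fun do rewrite exprS.
  exact: continuous_scale (@continuous_tcoord R k j) IH.
have cXz j : continuous (fun z : T => tcoord z j ^ n j : R[i]^o).
  case: (n j) => i; first exact: cX.
  move=> z; apply: (@continuous_comp T R[i]^o R[i]^o (fun z => tcoord z j ^+ i.+1)
    (fun c => c^-1)); first exact: cX.
  by apply: inv_continuous; rewrite expf_neq0// tcoord_neq0.
rewrite /torus_exp; elim: (index_enum _) => [|j s IH].
  by under eq_fun do rewrite big_nil; exact: cst_continuous.
under eq_fun do rewrite big_cons.
exact: continuous_scale (cXz j) IH.
Qed.

Lemma torus_exp_eqN1 p : p != 0 -> exists w, torus_exp w p = -1.
Proof.
move=> /eqP p0; have [j pj] : exists j, p j != 0.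
  apply/existsP; apply: contra_notT p0 => /existsPn p0.
  by apply/ffunP => j; rewrite ffunE; apply/eqP; have := p0 j; rewrite negbK.
have pj0 : (0 < `|p j|)%N by rewrite absz_gt0.
(* a root of -1 in one coordinate in which p is nonzero, 1 in the others *)
pose c : R[i] := `|p j|%N.-root (-1).
have cE : c ^+ `|p j| = -1 by rewrite rootCK.
have c1 : `|c| = 1.
  apply/eqP; rewrite -(@pexpr_eq1 _ _ `|p j|)//.
  by rewrite -normrX cE normrN1.
have wP : (\row_i (if i == j then c else 1) : 'rV[R[i]^o]_k) \in torus_set R k.
  by apply/mem_set => i; rewrite mxE; case: ifP => _; rewrite ?normr1.
exists (exist (fun v => v \in torus_set R k) _ wP); rewrite /torus_exp (bigD1 j)//= big1 => [|i ij].
  rewrite /tcoord /= mxE eqxx mulr1; move: cE; case: (p j) => i /=.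
    by rewrite -exprnP.
  by rewrite NegzE -exprnN => ->; rewrite invrN1.
by rewrite /tcoord /= mxE (negbTE ij) exp1rz.
Qed.

End characters.

Section character_integrals.
Context (R : realType) (k : nat).
Local Notation T := (torus R k).
Local Notation B := (borel_torus R k).
Variable mu : {measure set B -> \bar R}.
Hypothesis hmu : normalised_haar mu.
Let mu1 : mu setT = 1%E. Proof. by case: hmu. Qed.

Lemma bochner_cst (V : completeNormedModType R[i]) (a : V) :
  bochner mu (fun _ : B => a) = a.
Proof.
apply: (bochnerE mu1); apply/bochner_approxP => e e0.
have sa : is_simple mu (fun _ : B => a).
  apply: (prob_simple mu1); first exact: finite_image_cst.
  by move=> v; rewrite preimage_cst; case: ifP.
exists (fun=> a); split => //.
- by under eq_integral do rewrite subrr nrm0; rewrite integral0 lee_fin ltW.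
rewrite /simple_integral (_ : range _ = [set a]).
  rewrite fsbig_set1 (_ : _ @^-1` _ = setT) ?mu1 ?scale1r ?subrr ?nrm0 ?ltW//.
  by apply/seteqP.
by apply/seteqP; split=> [_ [z _ <-]//|_ ->]; exists point.
Qed.

(** A translation that multiplies a nontrivial character by -1 shows that its
    integral is its own opposite. *)
Lemma bochner_character (V : completeNormedModType R[i]) (p : Zk k) (a : V) :
  bochner mu (fun z : B => torus_exp z p *: a) = if p == 0 then a else 0.
Proof.
case: eqP => [->|/eqP p0].
  by under eq_fun do rewrite torus_exp0 scale1r; exact: bochner_cst.
have [w wp] := @torus_exp_eqN1 R k p p0.
have cf : continuous (fun z : T => torus_exp z p *: a).
  by apply: continuous_scale; [exact: continuous_torus_exp|exact: cst_continuous].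
have := bochner_translate hmu w cf.
under eq_fun do rewrite torus_expM wp -scalerA.
rewrite (bochnerZ hmu)// scaleN1r => /eqP; rewrite eq_sym -subr_eq0 opprK -mulr2n.
by rewrite -scaler_nat scaler_eq0 pnatr_eq0 => /eqP.
Qed.

Let Rechi (p : Zk k) (z : T) : R := complex.Re (torus_exp z p).

Let Rechi_le1 p z : `|Rechi p z| <= 1.
Proof.
by rewrite -lecR (le_trans (normc_ge_Re _))// nrmE nrm_torus_exp.
Qed.

Let continuous_Rechi p : continuous (Rechi p).
Proof.
exact: continuous_Re (@continuous_torus_exp R k p).
Qed.

Let integrable_Rechi p : mu.-integrable setT (EFin \o (Rechi p : B -> R)).
Proof.
apply: measurable_bounded_integrable => //.
- by rewrite [X in (X < _)%E]mu1 ltry.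
- exact: (continuous_measurable_torus (@continuous_Rechi p)).
- exists 1; split; first exact: num_real.
  by move=> x x1 z _ /=; rewrite (le_trans (Rechi_le1 _ _))// ltW.
Qed.

(* integral_translate asks for a nonnegative function, hence 1 + Rechi p below *)
Let integral_Rechi p : (\int[mu]_(z in setT) (Rechi p z)%:E = (p == 0)%:R%:E)%E.
Proof.
case: eqP => [->|/eqP p0].
  under eq_integral do rewrite /Rechi torus_exp0.
  by rewrite integral_cst//= mul1e.
have [w wp] := @torus_exp_eqN1 R k p p0.
have fin := integrable_fin_num measurableT (integrable_Rechi p).
have i1 : mu.-integrable setT (EFin \o cst (1 : R)).
  apply: measurable_bounded_integrable => //; first by rewrite [X in (X < _)%E]mu1 ltry.
  exists 1; split; first exact: num_real.
  by move=> x x1 z _ /=; rewrite normr1 ltW.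
have I1 : (\int[mu]_(z in setT) (cst (1 : R) z)%:E = 1)%E.
  by have := integral_cst mu measurableT 1%E; rewrite mu1 mul1e.
have := @integral_translate R k mu hmu w (fun z => 1 + Rechi p z) _ _.
have -> : (fun z => (1 + Rechi p (torus_mul w z))%:E) = (fun z => (cst 1 z)%:E - (Rechi p z)%:E)%E.
  by apply/funext => z; rewrite /Rechi torus_expM wp mulN1r raddfN -EFinB.
have -> : (fun z => (1 + Rechi p z)%:E) = (fun z => (cst 1 z)%:E + (Rechi p z)%:E)%E.
  by apply/funext => z; rewrite -EFinD.
rewrite integralB//; last exact: integrable_Rechi.
rewrite integralD//; last exact: integrable_Rechi.
rewrite I1 -(fineK fin) -EFinB -EFinD => H.
have {}H : 1 - fine (\int[mu]_(z in setT) (Rechi p z)%:E)%E =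
    1 + fine (\int[mu]_(z in setT) (Rechi p z)%:E)%E.
  apply: EFin_inj; apply: H.
  - apply: measurable_funD; [exact: measurable_cst|].
    exact: (continuous_measurable_torus (@continuous_Rechi p)).
  - by move=> z; have := Rechi_le1 p z; rewrite ler_norml; lra.
have I0 : fine (\int[mu]_(z in setT) (Rechi p z)%:E)%E = 0 by lra.
exact: (congr1 EFin I0).
Qed.

(** Only the constant characters contribute.  This gives the Fejer kernel total
    mass 1. *)
Lemma integral_trigonometric (c : R) (s : seq (Zk k)) :
  (\int[mu]_(z in setT) (c * \sum_(m <- s) complex.Re (torus_exp z (- m)))%:E =
   (c * \sum_(m <- s) (m == 0)%:R)%:E)%E.
Proof.
under eq_integral do rewrite EFinM -sumEFin.
rewrite integralZl//; last first.
  by apply: integrable_sum => // m _; exact: integrable_Rechi.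
rewrite integral_sum//; last by move=> m; exact: integrable_Rechi.
under eq_bigr do rewrite integral_Rechi oppr_eq0.
by rewrite sumEFin.
Qed.

End character_integrals.

(** * Boxes in Z^k *)

Section boxes.
Context (k : nat).
Implicit Types (u v m n p : Zk k) (N : Nk k).

(** Boxes are enumerated by finite functions into ordinals so that a sum of
    products over a box becomes a product of sums by distributivity. *)
Definition box_seq u v : seq (Zk k) :=
  [seq [ffun j => u j + (f j : nat)%:Z]
  | f : {ffun 'I_k -> 'I_(\max_j `|(v j - u j)%R|%N).+1}
    in family (fun j (l : 'I__) => (l <= `|(v j - u j)%R|)%N)].

Lemma mem_box_seq u v m : Zk_le u v -> m \in box_seq u v <-> Zk_itv u v m.
Proof.
move=> uv; rewrite /box_seq; split=> [/mapP[f + ->]|[um mv]].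
  rewrite mem_enum => /familyP fQ.
  split=> j; rewrite ffunE; have := uv j;
    have : (f j <= `|(v j - u j)%R|)%N := fQ j;
    move: (nat_of_ord (f j)) (u j) (v j) => x a b; lia.
apply/mapP; exists [ffun j => inord `|m j - u j|].
  rewrite mem_enum; apply/familyP => j; rewrite ffunE unfold_in inordK//.
    by have := um j; have := mv j; lia.
  rewrite ltnS (leq_trans _ (leq_bigmax j))//.
  by have := um j; have := mv j; lia.
apply/ffunP => j; rewrite !ffunE inordK.
  by have := um j; move: (u j) (m j) => a b; lia.
rewrite ltnS (leq_trans _ (leq_bigmax j))//.
by have := um j; have := mv j; lia.
Qed.

Lemma uniq_box_seq u v : uniq (box_seq u v).
Proof.
apply/dinjectiveP => f g _ _ /ffunP fg; apply/ffunP => j; apply: val_inj.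
by have := fg j; rewrite !ffunE => /addrI[].
Qed.

Lemma fsum_box (V : zmodType) u v (F : Zk k -> V) : Zk_le u v ->
  \sum_(m \in Zk_itv u v) F m = \sum_(m <- box_seq u v) F m.
Proof.
move=> uv; rewrite (fsbig_seq _ _ (uniq_box_seq u v)).
rewrite (_ : Zk_itv u v = [set` box_seq u v])//.
by apply/seteqP; split=> m /=; rewrite mem_box_seq.
Qed.

Lemma sum_box_prod (K : comNzRingType) u v (g : 'I_k -> int -> K) :
  \sum_(m <- box_seq u v) \prod_j g j (m j) =
  \prod_j \sum_(l < `|(v j - u j)%R|.+1) g j (u j + l%:Z).
Proof.
rewrite /box_seq big_image/=.
under eq_bigr do under eq_bigr do rewrite ffunE.
rewrite -(bigA_distr_big_dep (fun j (l : 'I__) => (l <= `|(v j - u j)%R|)%N)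
  (fun j (l : 'I__) => g j (u j + (l : nat)%:Z))).
apply: eq_bigr => j _; under eq_bigl do rewrite -ltnS.
rewrite -(big_ord_widen _ (fun l => g j (u j + l%:Z)))//.
by rewrite ltnS (leq_bigmax j).
Qed.

(** Keeping multiplicities turns the average of partial sums into one sum. *)
Definition fejer_seq N : seq (Zk k) :=
  [seq m | n <- box_seq 0 (Nk_Zk N), m <- box_seq (- n) n].

(** This reduces the Fejer kernel to dimension one, both for its positivity
    ([fejer_kernel_ge0]) and for its Fourier coefficients ([fejer_seq_count]). *)
Lemma sum_fejer_prod (K : comNzRingType) N (g : 'I_k -> int -> K) :
  \sum_(m <- fejer_seq N) \prod_j g j (m j) =
  \prod_j \sum_(i < (N j).+1) \sum_(l < (i + i).+1) g j (l%:Z - i%:Z).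
Proof.
rewrite big_allpairs_dep.
transitivity (\sum_(n <- box_seq 0 (Nk_Zk N))
    \prod_j \sum_(l < `|(n j - - n j)%R|.+1) g j (- n j + l%:Z)).
  apply: eq_bigr => n _; rewrite sum_box_prod; apply: eq_bigr => j _.
  by rewrite ffunE.
rewrite (sum_box_prod 0 _ (fun j i => \sum_(l < `|(i - - i)%R|.+1) g j (- i + l%:Z))).
apply: eq_bigr => j _; rewrite !ffunE subr0; apply: eq_bigr => i _.
rewrite add0r opprK; apply: eq_bigr => l _; by rewrite addrC.
Qed.

Lemma sum_interval_indicator (K : nzRingType) (i : nat) (p : int) :
  \sum_(l < (i + i).+1) (l%:Z - i%:Z == p)%:R = (`|p| <= i)%N%:R :> K.
Proof.
have [le|gt] := leqP.
  have lt : (`|(i%:Z + p)%R| < (i + i).+1)%N by lia.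
  rewrite (bigD1 (Ordinal lt))//= big1 ?addr0 => [|l /eqP ll].
    by rewrite (_ : _ == _)//; lia.
  case: eqP => // lp; exfalso; apply: ll; apply: val_inj => /=; lia.
by rewrite big1// => l _; case: eqP => // lp; have := ltn_ord l; lia.
Qed.

Lemma fejer_seq_count (K : comNzRingType) N p :
  \sum_(m <- fejer_seq N) (m == p)%:R = \prod_j ((N j).+1 - `|p j|)%N%:R :> K.
Proof.
transitivity (\sum_(m <- fejer_seq N) \prod_j (m j == p j)%:R : K).
  apply: eq_bigr => m _; case: eqP => [->|mp].
    by rewrite big1// => j _; rewrite eqxx.
  have [j mpj] : exists j, m j != p j.
    apply/existsP; apply: contra_notT mp => /existsPn mp.
    by apply/ffunP => j; apply/eqP; have := mp j; rewrite negbK.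
  by rewrite (bigD1 j)//= (negbTE mpj) mul0r.
rewrite (sum_fejer_prod N (fun j i => (i == p j)%:R)); apply: eq_bigr => j _.
under eq_bigr do rewrite sum_interval_indicator.
rewrite -natr_sum; congr _%:R; elim: (N j) => [|i IH].
  by rewrite big_ord_recr big_ord0 /=; lia.
by rewrite big_ord_recr IH /=; lia.
Qed.

End boxes.

(** * The Fejer kernel *)

Section fejer_kernel.
Context (R : realType).

(** By induction on N: adjoining z^(N+1) to the geometric sum S adds
    1 + z^(N+1) conj(S) + conj(z^(N+1)) S to its squared modulus, and this is the
    Dirichlet sum over -(N+1) <= m <= N+1. *)
Lemma fejer_kernel_circle (z : R[i]) (N : nat) : `|z| = 1 ->
  \sum_(i < N.+1) \sum_(l < (i + i).+1) z ^ (- (l%:Z - i%:Z)) =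
  `|\sum_(l < N.+1) z ^+ l| ^+ 2.
Proof.
move=> z1; have z0 : z != 0 by rewrite -normr_eq0 z1 oner_eq0.
have zJ : z^* = z^-1 by rewrite invC_norm z1 expr1n invr1 mul1r.
have zzJ n : z ^+ n * (z ^+ n)^* = 1.
  by rewrite -normCK normrX z1 !expr1n.
elim: N => [|N IH].
  by rewrite big_ord1 /= addn0 !big_ord1 expr0 normr1 expr1n.
rewrite big_ord_recr IH [in RHS]big_ord_recr /=.
set S := \sum_(l < N.+1) z ^+ l.
rewrite !normCK rmorphD /= mulrDl !mulrDr -!addrA; congr (_ + _).
rewrite zzJ [_ * S^* + 1]addrC.
(* split the Dirichlet sum into positive, zero and negative exponents *)
have -> : (N.+1 + N.+1).+1 = (N.+1 + (1 + N.+1))%N by lia.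
rewrite !big_split_ord /= big_ord1 /= addn0 subrr oppr0 expr0z.
rewrite addrCA [RHS]addrCA; congr (_ + _); rewrite addrC; congr (_ + _).
  rewrite mulr_suml [RHS](reindex_inj rev_ord_inj)/=; apply: eq_bigr => l _.
  have := ltn_ord l => lN.
  rewrite rmorphXn /= zJ exprVn exprnN exprnP -expfzDr//; congr (_ ^ _).
  by lia.
rewrite rmorph_sum mulr_sumr; apply: eq_bigr => l _.
rewrite rmorphXn /= zJ exprVn exprnN exprnP -expfzDr//; congr (_ ^ _).
by lia.
Qed.

Lemma fejer_kernel_ge0 (k : nat) (z : torus R k) (N : Nk k) :
  0 <= \sum_(m <- fejer_seq N) torus_exp z (- m).
Proof.
under eq_bigr do rewrite /torus_exp.
have -> : \sum_(m <- fejer_seq N) \prod_j tcoord z j ^ (- m) j =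
    \sum_(m <- fejer_seq N) \prod_j tcoord z j ^ (- m j).
  by apply: eq_bigr => m _; apply: eq_bigr => j _; rewrite ffunE.
rewrite (sum_fejer_prod N (fun j i => tcoord z j ^ (- i))).
apply: prodr_ge0 => j _; rewrite fejer_kernel_circle ?nrm_tcoord//.
Qed.

End fejer_kernel.
(** * Convergence of the Fejer means *)

Lemma Re_sum (R : realType) (I : Type) (s : seq I) (F : I -> R[i]) :
  complex.Re (\sum_(i <- s) F i) = \sum_(i <- s) complex.Re (F i).
Proof.
elim: s => [|i s IH]; first by rewrite !big_nil.
by rewrite !big_cons -IH; case: (F i) (\sum_(_ <- _) _) => a b [].
Qed.

#[local] Instance Nk_oo_filter (k : nat) : Filter (Nk_oo k).
Proof.
apply: filter_from_filter; first by exists [ffun=> 0%N].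
move=> M N _ _; exists [ffun j => maxn (M j) (N j)] => // n le.
by split=> j; have := le j; rewrite !ffunE; lia.
Qed.

Lemma Nk_oo_coord (k : nat) (j : 'I_k) : (fun N : Nk k => N j) @ Nk_oo k --> \oo.
Proof.
move=> E [M _ ME]; exists [ffun=> M] => // N le; apply: ME => /=.
by have := le j; rewrite !ffunE; lia.
Qed.

(** The p-th Fourier coefficient of the Fejer kernel tends to 1. *)
Lemma fejer_weight_cvg1 (R : realType) (k : nat) (p : Zk k) :
  (fun N : Nk k => \prod_j (((N j).+1 - `|p j|)%N%:R / (N j).+1%:R) : R)
    @ Nk_oo k --> (1 : R).
Proof.
have weight1 (q : nat) : ((n.+1 - q)%N%:R / n.+1%:R : R) @[n --> \oo] --> (1 : R).
  apply/cvgrPdist_le => e e0.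
  have q0 : (q%:R * n.+1%:R^-1 : R) @[n --> \oo] --> (0 : R).
    by rewrite -[X in _ --> X](mulr0 q%:R); apply: cvgM; [exact: cvg_cst|exact: cvg_harmonic].
  have /cvgrPdist_le/(_ e e0) := q0; apply: filterS => n.
  rewrite sub0r normrN; apply: le_trans.
  rewrite (_ : 1 - _ = (n.+1%:R - (n.+1 - q)%N%:R) / n.+1%:R); last first.
    by rewrite mulrBl divff.
  rewrite !ger0_norm ?mulr_ge0//; last first.
    by rewrite subr_ge0 ler_nat leq_subr.
  by rewrite ler_wpM2r// lerBlDr -natrD ler_nat; lia.
elim: (index_enum _) => [|j s IH].
  rewrite (_ : (fun N => _) = cst 1); first exact: cvg_cst.
  by apply/funext => N; rewrite big_nil.
pose w i (N : Nk k) : R := ((N i).+1 - `|p i|)%N%:R / (N i).+1%:R.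
rewrite (_ : (fun N => _) = (fun N => w j N * \prod_(i <- s) w i N)); last first.
  by apply/funext => N; rewrite big_cons.
rewrite -[X in _ --> X]mulr1.
apply: cvgM => //; exact: (cvg_comp _ _ (@Nk_oo_coord k j) (weight1 `|p j|%N)).
Qed.

Section fejer.
Context (R : realType) (k : nat) (A : cstarAlgType R) (alpha : torus R k -> A -> A).
Hypothesis halpha : strongly_continuous_action alpha.
Local Notation B := (borel_torus R k).
Variable mu : {measure set B -> \bar R}.
Hypothesis hmu : normalised_haar mu.
Implicit Types (a b x : A) (m n p : Zk k) (N : Nk k).

Let alphaL z (c : R[i]) a b : alpha z (c *: a + b) = c *: alpha z a + alpha z b.
Proof. by case: (sca_aut halpha z) => + _ _ _; apply. Qed.

Lemma action_contractive z a : nrm (alpha z a) <= nrm a.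
Proof. by case: (sca_aut halpha z) => L M S _; exact: hom_contractive. Qed.

Lemma continuous_coef_integrand a m :
  continuous (fun z => torus_exp z m *: alpha z a).
Proof.
apply: continuous_scale; first exact: continuous_torus_exp.
exact: (sca_continuous halpha).
Qed.

Lemma fourier_coef_linear (c : R[i]) a b m :
  fourier_coef mu alpha (c *: a + b) m =
  c *: fourier_coef mu alpha a m + fourier_coef mu alpha b m.
Proof.
rewrite /fourier_coef -(bochner_linear hmu); try exact: continuous_coef_integrand.
congr bochner; apply/funext => z.
by rewrite alphaL scalerDr !scalerA mulrC.
Qed.

Definition fejer_norm N : R := \prod_j (N j).+1%:R.

Lemma fejer_norm_gt0 N : 0 < fejer_norm N.
Proof. by apply: prodr_gt0 => j _. Qed.

Lemma fejer_meanE N a : fejer_mean mu alpha N a =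
  (fejer_norm N)^-1%:C *: \sum_(m <- fejer_seq N) fourier_coef mu alpha a m.
Proof.
rewrite /fejer_mean /fejer_norm; congr (_ *: _).
  by rewrite fmorphV rmorph_prod; congr _^-1; apply: eq_bigr => j _; rewrite rmorph_nat.
have N0 : Zk_le 0 (Nk_Zk N) by move=> j; rewrite !ffunE.
rewrite fsum_box// big_allpairs_dep !big_seq; apply: eq_bigr => n.
move=> /(mem_box_seq _ N0)[n0 _]; apply: fsum_box => j.
by have := n0 j; rewrite !ffunE; move: (n j) => i; lia.
Qed.

Lemma fejer_mean_linear (c : R[i]) N a b : fejer_mean mu alpha N (c *: a + b) =
  c *: fejer_mean mu alpha N a + fejer_mean mu alpha N b.
Proof.
rewrite !fejer_meanE; under eq_bigr do rewrite fourier_coef_linear.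
by rewrite big_split/= -scaler_sumr scalerDr !scalerA mulrC.
Qed.

Lemma fejer_mean_bochner N a : fejer_mean mu alpha N a =
  bochner mu (fun z : B => (fejer_norm N)^-1%:C *:
    \sum_(m <- fejer_seq N) torus_exp z (- m) *: alpha z a).
Proof.
rewrite fejer_meanE (bochnerZ hmu); last first.
  by apply: continuous_sum => m; exact: continuous_coef_integrand.
by rewrite (bochner_sum hmu)// => m; exact: continuous_coef_integrand.
Qed.

(** The Fejer mean averages the vectors [alpha z a], of norm at most that of a,
    against a nonnegative kernel of total mass 1. *)
Lemma fejer_mean_contractive N a : nrm (fejer_mean mu alpha N a) <= nrm a.
Proof.
have c0 := fejer_norm_gt0 N; have ci0 : 0 <= (fejer_norm N)^-1 by rewrite invr_ge0 ltW.
rewrite fejer_mean_bochner -lee_fin.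
set f := (fun z => _).
have cf : continuous (f : torus R k -> A).
  have cs : continuous (fun z => \sum_(m <- fejer_seq N) torus_exp z (- m) *: alpha z a).
    by apply: continuous_sum => m; exact: continuous_coef_integrand.
  by apply: continuous_scale cs; exact: cst_continuous.
apply: (le_trans (nrm_bochner_le hmu cf)).
pose K (z : torus R k) : R := \sum_(m <- fejer_seq N) complex.Re (torus_exp z (- m)).
have KE z : nrm (\sum_(m <- fejer_seq N) torus_exp z (- m)) = K z.
  by rewrite /nrm ger0_norm ?fejer_kernel_ge0// Re_sum.
have cK : continuous K.
  rewrite /K; under eq_fun do rewrite -Re_sum.
  apply: continuous_Re; apply: (@continuous_sum _ R[i]^o) => m.
  exact: continuous_torus_exp.
have -> : (nrm a)%:E =
    (\int[mu]_(z in setT) (nrm a * (fejer_norm N)^-1 * K z)%:E)%E.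
  rewrite (integral_trigonometric hmu) (fejer_seq_count _ N 0).
  congr EFin; rewrite (_ : \prod_j _ = fejer_norm N).
    by rewrite mulfVK// gt_eqF.
  by apply: eq_bigr => j _; rewrite ffunE subn0.
apply: ge0_le_integral => //.
- by move=> z _; rewrite lee_fin nrm_ge0.
- apply/measurable_EFinP; exact: (continuous_measurable_torus (continuous_nrm cf)).
- apply/measurable_EFinP; apply: measurable_funM; first exact: measurable_cst.
  exact: continuous_measurable_torus.
- move=> z _; rewrite lee_fin /f nrmZr// -scaler_suml nrmZ KE.
  rewrite [nrm a * _]mulrC -mulrA ler_wpM2l// mulrC ler_wpM2r ?action_contractive//.
  by rewrite -KE nrm_ge0.
Qed.

Variable A_ : Zk k -> set A.
Hypothesis halphaA : implements_grading A_ alpha.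

Lemma fourier_coef_homogeneous p x m : A_ p x ->
  fourier_coef mu alpha x m = (m == p)%:R *: x.
Proof.
move=> Ax; rewrite /fourier_coef.
under eq_fun do rewrite (halphaA _ Ax) scalerA -torus_expD addrC.
rewrite (bochner_character hmu) subr_eq0 eq_sym.
by case: eqP => _; rewrite ?scale1r ?scale0r.
Qed.

Lemma fejer_mean_homogeneous p x : A_ p x ->
  fejer_mean mu alpha N x @[N --> Nk_oo k] --> x.
Proof.
move=> Ax; apply/nrm_cvgP => e e0.
have e1 : 0 < e / (nrm x + 1) by rewrite divr_gt0// ltr_wpDl// nrm_ge0.
have /cvgrPdist_le/(_ _ e1) := @fejer_weight_cvg1 R k p.
apply: filterS => N; set r := \prod_j _ => le.
have -> : fejer_mean mu alpha N x - x = (r - 1)%:C *: x.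
  rewrite fejer_meanE; under eq_bigr do rewrite (fourier_coef_homogeneous _ Ax).
  rewrite -scaler_suml fejer_seq_count scalerA rmorphB scalerBl scale1r.
  congr (_ *: _ - _); rewrite /r big_split/= prodfV mulrC rmorphM /= -/(fejer_norm N).
  by congr (_ * _); rewrite rmorph_prod; apply: eq_bigr => j _; rewrite rmorph_nat.
have -> : nrm ((r - 1)%:C *: x) = `|r - 1| * nrm x.
  rewrite nrmZ; congr (_ * _); apply: complexI.
  by rewrite -nrmE normc_def /= expr0n addr0 sqrtr_sqr.
move: le; rewrite distrC ler_pdivlMr ?ltr_wpDl ?nrm_ge0//.
by apply: le_trans; rewrite ler_wpM2l// lerDl.
Qed.

Lemma fejer_mean_algebraic a : algebraic_sum A_ a ->
  fejer_mean mu alpha N a @[N --> Nk_oo k] --> a.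
Proof.
have mean0 N : fejer_mean mu alpha N 0 = 0.
  by have := fejer_mean_linear (-1) N 0 0; rewrite scaler0 addr0 scaleN1r addNr.
move=> [s [x [Ax ->]]]; elim: s => [|n s IH].
  rewrite big_nil (_ : (fun N => _) = cst 0); last exact/funext.
  exact: cvg_cst.
rewrite big_cons (_ : (fun N => _) = (fun N => fejer_mean mu alpha N (x n) +
    fejer_mean mu alpha N (\sum_(i <- s) x i))); last first.
  by apply/funext => N; have := fejer_mean_linear 1 N (x n) (\sum_(i <- s) x i); rewrite !scale1r.
by apply: cvgD => //; exact: fejer_mean_homogeneous.
Qed.

(** Contractivity extends the convergence from a dense set to its closure. *)
Lemma fejer_mean_cvg a : closure (algebraic_sum A_) a ->
  fejer_mean mu alpha N a @[N --> Nk_oo k] --> a.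
Proof.
move=> cla; apply/nrm_cvgP => e e0.
have e3 : 0 < e / 3 by rewrite divr_gt0.
have e3C : 0 < (e / 3)%:C by rewrite ltcR.
have [b [Sb]] := cla _ (nbhsx_ballx a _ e3C).
rewrite -ball_normE /= nrmE ltcR => ab.
have /nrm_cvgP/(_ _ e3) := fejer_mean_algebraic Sb; apply: filterS => N bN.
have -> : fejer_mean mu alpha N a - a = fejer_mean mu alpha N (a - b) +
    (fejer_mean mu alpha N b - b) + (b - a).
  have -> : fejer_mean mu alpha N a =
      fejer_mean mu alpha N (a - b) + fejer_mean mu alpha N b.
    by have := fejer_mean_linear 1 N (a - b) b; rewrite !scale1r subrK.
  by rewrite !addrA subrK.
have := nrmD (fejer_mean mu alpha N (a - b) + (fejer_mean mu alpha N b - b)) (b - a).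
have := nrmD (fejer_mean mu alpha N (a - b)) (fejer_mean mu alpha N b - b).
have := fejer_mean_contractive N (a - b); rewrite (nrm_distC b a); lra.
Qed.

End fejer.

Theorem corollary7 (R : realType) (k : nat) (hk : (1 <= k)%N)
    (A : cstarAlgType R) (A_ : Zk k -> set A) (hA : exel_grading A_)
    (F : A -> A) (hF : bounded_projection A_ F)
    (alpha : torus R k -> A -> A)
    (halpha : strongly_continuous_action alpha)
    (halphaA : implements_grading A_ alpha)
    (mu : {measure set (borel_torus R k) -> \bar R})
    (hmu : normalised_haar mu) :
  forall a : A,
    `|fejer_mean mu alpha N a - a| @[N --> Nk_oo k] --> (0 : R[i]^o).
Proof.
move=> a; apply/nrm_cvgP => e e0.
have : closure (algebraic_sum A_) a by rewrite (exel_dense hA).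
move=> /(fejer_mean_cvg halpha hmu halphaA)/nrm_cvgP/(_ e e0).
by apply: filterS => N; rewrite subr0 /nrm normr_id.
Qed.
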